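(* Let $\tilde\omega\ge\omega\ge 0$ and consider the family $\{\mathcal{L}_\lambda\}_{\lambda>\tilde\omega}$, where $\mathcal{L}_\lambda=\lambda^2(\lambda I-\mathcal{L})^{-1}-\lambda I$ is the Yosida approximation of the Koopman generator $\mathcal{L}$ of $\dot x=f(x)$. Then $\mathcal{L}_\lambda\to\mathcal{L}$ strongly as $\lambda\to\infty$, i.e. $\lim_{\lambda\to\infty}\|\mathcal{L}_\lambda h-\mathcal{L}h\|=0$ for every $h\in\operatorname{dom}(\mathcal{L})$. Moreover, for any $h\in\mathcal{C}^2(\Omega)$, $$\|\mathcal{L}_\lambda h-\mathcal{L}h\|\lesssim(\lambda-\tilde\omega)^{-1}\big(\|h\|_{\mathcal{L}}+\|\mathcal{L}h\|_{\mathcal{L}}\big).$$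
   Context: $\Omega\subseteq\mathbb{R}^d$ is a pre-compact state space and $f$ is a locally Lipschitz vector field on $\Omega$; the flow $\phi(t,x)$ of $\dot x=f(x)$ is assumed to exist and stay in $\Omega$ for all $t\ge 0$, $x\in\Omega$. $\mathcal{C}(\Omega)$ is the Banach space of real-valued continuous functions on $\Omega$ with the uniform norm $\|h\|=\sup_{x\in\Omega}|h(x)|$, and $\mathcal{C}^i(\Omega)$ is the set of $i$-times continuously differentiable functions. The Koopman operators $\mathcal{K}_t:\mathcal{C}(\Omega)\to\mathcal{C}(\Omega)$, $\mathcal{K}_th=h\circ\phi(t,\cdot)$, $t\ge0$, form a $\mathcal{C}_0$-semigroup, and $C\ge1$, $\omega\ge0$ are constants with $\|\mathcal{K}_t\|\le Ce^{\omega t}$ for all $t\ge0$. The generator is $\mathcal{L}h=\lim_{t\downarrow0}(\mathcal{K}_th-h)/t$, with $\operatorname{dom}(\mathcal{L})$ the set of $h\in\mathcal{C}(\Omega)$ for which the limit exists; for $h\in\mathcal{C}^1(\Omega)$, $\mathcal{L}h=\nabla h\cdot f$. The graph norm is $\|\cdot\|_{\mathcal{L}}=\|\cdot\|+\|\mathcal{L}(\cdot)\|$. The notation $a\lesssim b$ means that there is a constant $c>0$, independent of $a$ and $b$, such that $a\le cb$.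
   Formalization: For f only locally Lipschitz, Lh may lie outside dom(L) for some h in C^2(Ω), so ‖Lh‖_L is undefined; the formal statement sets the graph norm to +∞ there, so the estimate has content exactly when Lh ∈ dom(L). *)

(* Defs.v *)
From HB Require Import structures.
From mathcomp Require Import all_boot all_order all_algebra.
From mathcomp Require Import all_classical all_reals all_analysis.

Set Implicit Arguments.
Unset Strict Implicit.
Unset Printing Implicit Defensive.

Import Order.TTheory GRing.Theory Num.Theory.
Import numFieldNormedType.Exports.

Local Open Scope classical_set_scope.
Local Open Scope ring_scope.

(* The space of bounded continuous functions T -> R with the uniform norm.
   Boundedness is automatic when T is compact; when T is only pre-compact it is
   what makes the uniform norm finite. *)
Section bounded_continuous_functions.
Context {R : realType} {T : topologicalType}.

Definition bcont : {pred T -> R^o} :=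
  [pred h : T -> R^o | `[< continuous h /\ bounded_fun h >]].

Lemma bcontP (h : T -> R^o) :
  reflect (continuous h /\ exists M : R, forall x, `|h x| <= M) (h \in bcont).
Proof.
apply: (iffP (asboolP _)) => -[ch bh]; split=> //.
  have [M _ hM] := ex_strict_bound_gt0 bh.
  by exists M => x; apply/ltW; apply: hM.
have [M hM] := bh; exists M; split; first exact: num_real.
by move=> N MN x _; apply: le_trans (ltW MN).
Qed.

Lemma bcont_submod_closed : submod_closed bcont.
Proof.
split=> [|a u v /bcontP[cu [M uM]] /bcontP[cv [N vN]]]; apply/bcontP; split.
- exact: cst_continuous.
- by exists 0 => x; rewrite normr0.
- move=> x; apply: (@cvgD _ R^o); last exact: cv.
  by apply: (@cvgZr _ R^o); exact: cu.
exists (`|a| * M + N) => x.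
apply: le_trans (ler_normD _ _) _; apply: lerD; last exact: vN.
by rewrite normrZ ler_wpM2l.
Qed.

HB.instance Definition _ :=
  GRing.isSubmodClosed.Build R (T -> R^o) bcont
    (GRing.submod_closed_semi bcont_submod_closed).
HB.instance Definition _ :=
  GRing.isOppClosed.Build (T -> R^o) bcont
    (GRing.zmod_closedN (GRing.submod_closedB bcont_submod_closed)).

End bounded_continuous_functions.

Section bcfun_type.
Variables (R : realType) (T : topologicalType).

Record bcfun := BCFun {
  bcfun_fun :> T -> R^o;
  bcfun_subproof : bcfun_fun \in bcont }.

HB.instance Definition _ := [isSub for bcfun_fun].
HB.instance Definition _ := [Choice of bcfun by <:].
HB.instance Definition _ := [SubChoice_isSubLmodule of bcfun by <:].

Implicit Types h : bcfun.

Definition uniform_norm h : R := sup [set `|h x| | x in [set: T]].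

Lemma bcfunP h1 h2 : (forall x, h1 x = h2 x) -> h1 = h2.
Proof. by move=> h12; apply/val_inj/funext. Qed.

Lemma bcfun_continuous h : continuous h.
Proof. by have /bcontP[] := bcfun_subproof h. Qed.

Lemma bcfun_has_ubound h : has_ubound [set `|h x| | x in [set: T]].
Proof.
have /bcontP[_ [M hM]] := bcfun_subproof h.
by exists M => _ [x _ <-]; exact: hM.
Qed.

Lemma uniform_norm_ge h x : `|h x| <= uniform_norm h.
Proof. by apply: ub_le_sup; [exact: bcfun_has_ubound|exists x]. Qed.

Lemma uniform_norm_ge0 h : 0 <= uniform_norm h.
Proof.
rewrite /uniform_norm.
have [->|/set0P[_ [x _ _]]] := eqVneq [set `|h x| | x in [set: T]] set0.
  by rewrite sup0.
exact: le_trans (normr_ge0 (h x)) (uniform_norm_ge h x).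
Qed.

Lemma uniform_norm_le h (M : R) :
  0 <= M -> (forall x, `|h x| <= M) -> uniform_norm h <= M.
Proof.
move=> M0 hM; rewrite /uniform_norm.
have [->|S0] := eqVneq [set `|h x| | x in [set: T]] set0; first by rewrite sup0.
by apply: ge_sup; [exact/set0P|move=> _ [x _ <-]; exact: hM].
Qed.

Lemma uniform_normD h1 h2 :
  uniform_norm (h1 + h2) <= uniform_norm h1 + uniform_norm h2.
Proof.
apply: uniform_norm_le => [|x]; first by rewrite addr_ge0 ?uniform_norm_ge0.
by apply: le_trans (ler_normD _ _) _; rewrite lerD ?uniform_norm_ge.
Qed.

Lemma uniform_normZ (a : R) h : uniform_norm (a *: h) = `|a| * uniform_norm h.
Proof.
apply/eqP; rewrite eq_le; apply/andP; split.
  apply: uniform_norm_le => [|x]; first by rewrite mulr_ge0 ?uniform_norm_ge0.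
  by rewrite [(a *: h) x]/(a *: (h x)) normrZ ler_wpM2l ?uniform_norm_ge.
have [->|a0] := eqVneq a 0; first by rewrite normr0 mul0r uniform_norm_ge0.
rewrite -ler_pdivlMl ?normr_gt0//; apply: uniform_norm_le => [|x].
  by rewrite mulr_ge0 ?uniform_norm_ge0// invr_ge0.
rewrite ler_pdivlMl ?normr_gt0// -normrZ.
exact: (uniform_norm_ge (a *: h)).
Qed.

Lemma uniform_norm0_eq0 h : uniform_norm h = 0 -> h = 0.
Proof.
move=> h0; apply: bcfunP => x; apply/eqP; rewrite -normr_eq0 eq_le normr_ge0.
by rewrite andbT -h0 uniform_norm_ge.
Qed.

HB.instance Definition _ := Lmodule_isNormed.Build R bcfun
  uniform_normD uniform_normZ uniform_norm0_eq0.

End bcfun_type.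

(* C(Omega) is bcfun R Omega: a set, seen as a type, carries the subspace
   topology. *)
Section dynamics.
Context {R : realType} {d : nat}.
Implicit Types (Omega U : set 'rV[R]_d) (f : 'rV[R]_d -> 'rV[R]_d).

(* phi is the forward flow of x' = f x on Omega; that it stays in Omega is
   encoded in its type.  The values phi t x with t < 0 are irrelevant. *)
Definition is_flow Omega f (phi : R -> Omega -> Omega) : Prop :=
  forall x : Omega,
    [/\ phi 0 x = x,
        {within `[0, +oo[, continuous (fun t : R => set_val (phi t x))}
      & forall t : R, 0 < t ->
          is_derive t 1 (fun s : R => set_val (phi s x))
            (f (set_val (phi t x)))].

Definition is_koopman Omega (phi : R -> Omega -> Omega)
    (K : R -> bcfun R Omega -> bcfun R Omega) : Prop :=
  forall t : R, 0 <= t -> forall (h : bcfun R Omega) (x : Omega),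
    K t h x = h (phi t x).

(* g is n times (Frechet) differentiable on the open set U and its directional
   derivatives up to order n are continuous on U. *)
Fixpoint Cn_on (n : nat) U (g : 'rV[R]_d -> R^o) : Prop :=
  if n is m.+1 then
    (forall x, U x -> differentiable g x) /\
    (forall v, Cn_on m U (fun x => 'D_v g x))
  else forall x, U x -> {for x, continuous g}.

(* As Omega need not be open, h is of class C^n on Omega when it is the
   restriction of a function of class C^n on an open neighbourhood of Omega. *)
Definition Cn n Omega : set (bcfun R Omega) :=
  [set h | exists U (g : 'rV[R]_d -> R^o),
     [/\ open U, Omega `<=` U, Cn_on n U g
       & forall x : Omega, h x = g (set_val x)]].

End dynamics.

Section semigroups.
Context {R : realType} {V : normedModType R}.
Implicit Types (T : R -> V -> V) (D : set V) (A : V -> V).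

Definition C0_semigroup T : Prop :=
  [/\ forall t, 0 <= t -> linear (T t) /\ continuous (T t),
      forall v, T 0 v = v,
      forall s t, 0 <= s -> 0 <= t -> forall v, T (s + t) v = T s (T t v)
    & forall v, T t v @[t --> 0^'+] --> v].

Definition difference_quotient T (v : V) (t : R) : V := t^-1 *: (T t v - v).

Definition generator_dom T : set V :=
  [set v | cvg (difference_quotient T v t @[t --> 0^'+])].

(* Only meaningful on generator_dom T. *)
Definition generator T (v : V) : V :=
  lim (difference_quotient T v t @[t --> 0^'+]).

(* (lambda I - A)^-1 as the inverse of lambda I - A : D -> V. *)
Definition resolvent D A (lambda : R) : V -> V :=
  'pinv_(fun=> 0) D (fun v => lambda *: v - A v).

Definition yosida T (lambda : R) (v : V) : V :=
  lambda ^+ 2 *: resolvent (generator_dom T) (generator T) lambda v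
  - lambda *: v.

(* The graph norm of (D, A), set to +oo outside D. *)
Definition graph_norm D A (v : V) : \bar R :=
  if v \in D then (`|v| + `|A v|)%:E else +oo%E.

End semigroups.

(* Main.v *)
Require Import Defs.
From HB Require Import structures.
From mathcomp Require Import all_boot all_order all_algebra.
From mathcomp Require Import all_classical all_reals all_analysis.
From mathcomp Require Import lra.

Import Order.TTheory GRing.Theory Num.Theory.
Import numFieldNormedType.Exports.

Local Open Scope classical_set_scope.
Local Open Scope ring_scope.

Set Implicit Arguments.
Unset Strict Implicit.
Unset Printing Implicit Defensive.

(** Composition with the flow cannot increase a supremum, so the Koopman
operators are contractions.  The statement about Yosida approximations then
holds for any commuting family of linear contractions T_t on a Banach space,
and the statement about C^2 functions reduces to showing that they lie in the
domain of the generator.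

Yosida approximations.  Let A_t = (T_t - 1) / t, whose limit as t decreases to
0 is the generator L with domain D.  Contractivity gives
lambda |v| <= |lambda v - A_t v| ([difference_quotient_dissipative]), hence the
same for L ([generator_dissipative]).  The equation lambda r - L r = h is
solved for h in D only ([generator_resolvent]), with no vector-valued integral:
the solutions r_t of lambda r_t - A_t r_t = h exist by Banach's fixed point
theorem, and commutation gives
lambda^2 |r_t - r_s| <= |A_t h - A_s h|, so they converge as t decreases to 0.
For h in D with solution r, the vector y = L r = lambda r - h is in D and
satisfies lambda y - L y = L h, and the Yosida approximation at h is lambda y
([yosidaE]).  If L h is in D, then lambda y - L h is the solution for the right
hand side L (L h), so its norm is at most |L (L h)| / lambda ([yosida_le]).  In
general L h is a limit of vectors A_t h of D, which gives strong convergence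
([yosida_cvg]).

Functions of class C^2.  Let k be the derivative of h along f, a continuous
function on Omega.  By the mean value theorem along orbits,
(K_t h - h) / t at x is the value of k at phi(s, x) for some s in (0, t); if k
is bounded, strong continuity of K at k makes this converge uniformly to k
([koopman_generator_dom]).  As Omega is only pre-compact, boundedness of k is
not immediate; it comes from strong continuity at the bounded functions cos k
and sin k: on a time interval that is uniform in x, the angle k cannot move by
2 along an orbit, so a large value of k at x would make h increase too much
along the orbit of x ([lie_derivative_bounded]). *)

(** * Contraction semigroups and their Yosida approximations *)

Lemma subrACA (V : zmodType) (a b c d : V) :
  (a - b) - (c - d) = (a - c) - (b - d).
Proof. by rewrite [in LHS]opprD addrACA -opprD. Qed.

Section contraction_semigroup.
Context {R : realType} {V : completeNormedModType R} (T : R -> V -> V).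
Hypothesis T_linear : forall t : R, 0 <= t -> linear (T t).
Hypothesis T_contraction : forall t : R, 0 <= t -> forall v, `|T t v| <= `|v|.
Hypothesis T_comm : forall s t : R, 0 <= s -> 0 <= t ->
  forall v, T s (T t v) = T t (T s v).

Local Notation A t v := (difference_quotient T v t).
Local Notation D := (generator_dom T).
Local Notation L := (generator T).

Let TP (t : R) a u v : 0 <= t -> T t (a *: u + v) = a *: T t u + T t v.
Proof. by move=> t0; rewrite (T_linear t0). Qed.

Let TB (t : R) u v : 0 <= t -> T t (u - v) = T t u - T t v.
Proof. by move=> t0; rewrite -scaleN1r addrC TP// scaleN1r addrC. Qed.

Let TZ (t : R) a u : 0 <= t -> T t (a *: u) = a *: T t u.
Proof.
move=> t0; have T0 : T t 0 = 0 by rewrite -{1}(subrr u) TB// subrr.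
by rewrite -[a *: u]addr0 TP// T0 addr0.
Qed.

Let AB (t : R) u v : 0 <= t -> A t (u - v) = A t u - A t v.
Proof.
move=> t0; rewrite /difference_quotient TB// -scalerBr; congr (_ *: _).
by rewrite !opprB addrACA [RHS]addrACA [- u - _]addrC.
Qed.

Let AZ (t : R) a u : 0 <= t -> A t (a *: u) = a *: A t u.
Proof.
by move=> t0; rewrite /difference_quotient TZ// -scalerBr !scalerA mulrC.
Qed.

Let TA (s t : R) v : 0 <= s -> 0 <= t -> T s (A t v) = A t (T s v).
Proof. by move=> s0 t0; rewrite /difference_quotient TZ// TB// T_comm. Qed.

Let AA (s t : R) v : 0 <= s -> 0 <= t -> A s (A t v) = A t (A s v).
Proof.
by move=> s0 t0; rewrite {1}/difference_quotient TA// -AB// -AZ.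
Qed.

(** The left-hand side is (lambda + 1/t) v - (1/t) T_t v, and |T_t v| <= |v|. *)
Lemma difference_quotient_dissipative lambda t v : 0 < t ->
  lambda * `|v| <= `|lambda *: v - A t v|.
Proof.
move=> t0; rewrite /difference_quotient scalerBr opprB addrA -scalerDl.
apply: le_trans (lerB_normD _ _); rewrite normrN !normrZ.
have t'0 : 0 < t^-1 by rewrite invr_gt0.
rewrite (ger0_norm (ltW t'0)).
have : t^-1 * `|T t v| <= t^-1 * `|v|.
  by rewrite ler_pM2l// T_contraction// ltW.
have : (lambda + t^-1) * `|v| <= `|lambda + t^-1| * `|v|.
  by rewrite ler_wpM2r// ler_norm.
rewrite mulrDl; lra.
Qed.

(** The equation reads r = (t v + T_t r) / (1 + lambda t), a fixed point of a
map with Lipschitz constant 1 / (1 + lambda t) < 1. *)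
Lemma difference_quotient_resolvent lambda t v : 0 < lambda -> 0 < t ->
  exists r, lambda *: r - A t r = v.
Proof.
move=> l0 t0.
have q1 : 0 < (1 + lambda * t)^-1 < 1.
  rewrite invr_gt0 invf_lt1; have := mulr_gt0 l0 t0; lra.
set q := (1 + _)^-1 in q1; have [q0 {}q1] := andP q1.
pose F r := q *: (t *: v + T t r).
have Ffun : set_fun [set: V] [set: V] F by [].
pose F' : {fun [set: V] >-> [set: V]} := HB.pack F (isFun.Build _ _ _ _ F Ffun).
have ctr : is_contraction F'.
  exists (NngNum (ltW q0)); split=> //= -[x y] _ /=.
  rewrite /F -scalerBr normrZ ger0_norm ?ler_pM2l// ?(ltW q0)//.
  by rewrite opprD addrACA subrr add0r -TB ?T_contraction// ltW.
have [||r _ rF] := banach_fixed_point ctr.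
- exact: closedT.
- by exists 0.
exists r; have {rF} : q^-1 *: r = t *: v + T t r.
  by rewrite [in LHS]rF /= /F scalerA mulVf ?scale1r// gt_eqF.
rewrite /q invrK scalerDl scale1r => rE.
rewrite /difference_quotient -[lambda *: r](@scalerK _ _ t) ?gt_eqF//.
rewrite -scalerBr scalerA [t * _]mulrC opprB addrA [_ + r]addrC rE addrK.
by rewrite scalerA mulVf ?scale1r// gt_eqF.
Qed.

Lemma generator_cvg v : D v -> A t v @[t --> 0^'+] --> L v.
Proof. by []. Qed.

Lemma cvg_generator v w : A t v @[t --> 0^'+] --> w -> D v /\ L v = w.
Proof. by move=> vw; split; [apply/cvg_ex; exists w|exact: cvg_lim]. Qed.

Lemma generatorB u v : D u -> D v -> D (u - v) /\ L (u - v) = L u - L v.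
Proof.
move=> Du Dv; apply: cvg_generator.
have : A t u - A t v @[t --> 0^'+] --> L u - L v by apply: cvgB.
apply: cvg_trans; apply: near_eq_cvg; near=> t.
by rewrite AB.
Unshelve. all: by end_near. Qed.

Lemma generatorZ a u : D u -> D (a *: u) /\ L (a *: u) = a *: L u.
Proof.
move=> Du; apply: cvg_generator.
have : a *: A t u @[t --> 0^'+] --> a *: L u by apply: cvgZr.
apply: cvg_trans; apply: near_eq_cvg; near=> t.
by rewrite AZ.
Unshelve. all: by end_near. Qed.

(** T_t commutes with A_s, so D is stable under T_t.  Since A_t v tends to L v,
this also shows that L maps D into the closure of D. *)
Lemma generator_dom_difference_quotient t v : 0 <= t -> D v -> D (A t v).
Proof.
move=> t0 Dv.
suff DT : D (T t v).
  rewrite /difference_quotient.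
  by apply: (generatorZ _ _).1; apply: (generatorB _ _).1.
apply: (proj1 (@cvg_generator _ (T t (L v)) _)).
apply/cvgrPdist_le => e e0; near=> s.
rewrite -TA// -TB//; apply: le_trans (T_contraction _ _) _ => //.
by near: s; move/cvgrPdist_le: (generator_cvg Dv); exact.
Unshelve. all: by end_near. Qed.

Lemma generator_dissipative lambda v : D v ->
  lambda * `|v| <= `|lambda *: v - L v|.
Proof.
move=> Dv; have cv : `|lambda *: v - A t v| @[t --> 0^'+] --> `|lambda *: v - L v|.
  by apply: cvg_norm; apply: cvgB => //; exact: cvg_cst.
rewrite -(cvg_lim _ cv)//; apply: limr_ge.
  by apply/cvg_ex; exists `|lambda *: v - L v|.
by near=> t; apply: difference_quotient_dissipative.
Unshelve. all: by end_near. Qed.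

(** The solution is the limit of the solutions r_t for A_t.  That A_t h
converges, for h in D, makes r_t Cauchy; that A_t is close to A_s on r_s,
uniformly in s, identifies the limit. *)
Lemma generator_resolvent lambda h : 0 < lambda -> D h ->
  exists2 r, D r & lambda *: r - L r = h.
Proof.
move=> l0 Dh.
have /choice[r rE] t : exists r, 0 < t -> lambda *: r - A t r = h.
  have [t0|] := ltP 0 t; last by exists 0.
  by have [r rE] := @difference_quotient_resolvent lambda t h l0 t0; exists r.
(* lambda - A_s maps (A_t - A_s) r_s to (A_t - A_s) h, as A_t and A_s commute. *)
have Adiff s t : 0 < s -> 0 < t ->
    lambda * `|A t (r s) - A s (r s)| <= `|A t h - A s h|.
  move=> s0 t0; apply: le_trans (difference_quotient_dissipative _ _ s0) _.
  rewrite -(rE s s0).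
  rewrite !AB ?(@AZ _ lambda) ?(ltW s0) ?(ltW t0)// (@AA s t) ?(ltW s0, ltW t0)//.
  by rewrite scalerBr subrACA.
(* lambda - A_t maps r_t - r_s to (A_t - A_s) r_s. *)
have rdiff s t : 0 < s -> 0 < t ->
    lambda ^+ 2 * `|r t - r s| <= `|A t h - A s h|.
  move=> s0 t0; apply: le_trans (Adiff s t s0 t0).
  rewrite expr2 -mulrA ler_pM2l//.
  apply: le_trans (difference_quotient_dissipative _ _ t0) _.
  rewrite scalerBr AB ?(ltW t0)// subrACA (rE t)// -(rE s s0).
  by rewrite subrACA subrr sub0r opprB.
have Ah := generator_cvg Dh.
have r_cvg : cvg (r t @[t --> 0^'+]).
  apply/cauchy_cvgP/cauchy_exP => e e0.
  have e'0 : 0 < lambda ^+ 2 * (e / 2) by rewrite mulr_gt0 ?exprn_gt0 ?divr_gt0.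
  near (0 : R)^'+ => t; exists (r t).
  suff : \forall s \near 0^'+, ball (r t) e (r s) by []; near=> s.
  rewrite -ball_normE /= -(@ltr_pM2l _ (lambda ^+ 2)) ?exprn_gt0//.
  apply: le_lt_trans (@rdiff s t _ _) _ => //.
  apply: le_lt_trans (ler_distD (L h) _ _) _.
  rewrite [e]splitr mulrDr ltrD//.
    by rewrite distrC; near: t; have /cvgrPdist_lt := Ah; exact.
  by near: s; have /cvgrPdist_lt := Ah; exact.
set rho := lim (r t @[t --> 0^'+]) in r_cvg.
(* Let s tend to 0 in Adiff, where A_s r_s = lambda r_s - h. *)
have Arho t : 0 < t -> lambda * `|A t rho - (lambda *: rho - h)| <= `|A t h - L h|.
  move=> t0.
  have Tr : T t (r s) @[s --> 0^'+] --> T t rho.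
    apply/cvgrPdist_le => e e0; near=> s.
    rewrite -TB ?(ltW t0)//; apply: le_trans (T_contraction (ltW t0) _) _.
    by near: s; have /cvgrPdist_le := r_cvg; exact.
  have lhs : lambda * `|A t (r s) - (lambda *: r s - h)| @[s --> 0^'+]
      --> lambda * `|A t rho - (lambda *: rho - h)|.
    apply: cvgM; first exact: cvg_cst.
    apply: cvg_norm; apply: cvgB.
      by apply: cvgZr; apply: cvgB.
    by apply: cvgB; [apply: cvgZr|exact: cvg_cst].
  have rhs : `|A t h - A s h| @[s --> 0^'+] --> `|A t h - L h|.
    by apply: cvg_norm; apply: cvgB => //; exact: cvg_cst.
  apply: ler_cvg_to lhs rhs _; near=> s.
  have s0 : 0 < s by [].
  by rewrite -{1}(rE s s0) subKr; exact: Adiff.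
have [|Drho Lrho] := @cvg_generator rho (lambda *: rho - h).
  apply/cvgrPdist_le => e e0; near=> t.
  have t0 : 0 < t by [].
  rewrite distrC -(@ler_pM2l _ lambda)//; apply: le_trans (Arho t t0) _.
  rewrite distrC; near: t; have /cvgrPdist_le := Ah; apply; exact: mulr_gt0.
by exists rho; rewrite // Lrho subKr.
Unshelve. all: by end_near. Qed.

(** [resolvent] is a partial inverse, hence meaningful where lambda - L is
injective on D, which is the dissipativity of L. *)
Lemma resolventE lambda h r : 0 < lambda -> D r -> lambda *: r - L r = h ->
  resolvent D L lambda h = r.
Proof.
move=> l0 Dr <-; rewrite /resolvent.
apply: (@pinvKV _ _ _ D (fun v => lambda *: v - L v)); last exact/mem_set.
move=> u v /set_mem Du /set_mem Dv uv.
have [Duv Luv] := generatorB Du Dv.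
have := generator_dissipative lambda Duv.
rewrite Luv scalerBr subrACA uv subrr normr0 pmulr_rle0// normr_le0 subr_eq0.
by move/eqP.
Qed.

(** If lambda r - L r = h, then y = L r = lambda r - h is again in D, and the
Yosida approximation lambda^2 r - lambda h equals lambda y. *)
Lemma yosidaE lambda h : 0 < lambda -> D h ->
  exists y, [/\ D y, lambda *: y - L y = L h & yosida T lambda h = lambda *: y].
Proof.
move=> l0 Dh; have [r Dr rE] := generator_resolvent l0 Dh.
have [Dlr Llr] := generatorZ lambda Dr.
have [Dy Ly] := generatorB Dlr Dh.
have LrE : L r = lambda *: r - h by rewrite -{1}rE subKr.
exists (lambda *: r - h); split=> //.
  by rewrite Ly Llr LrE subKr.
by rewrite /yosida (resolventE l0 Dr rE) scalerBr scalerA expr2.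
Qed.

(** The residual w = lambda y - u satisfies lambda w - L w = L u. *)
Lemma resolvent_residual_le lambda u y : 0 < lambda -> D u -> D y ->
  lambda *: y - L y = u -> `|lambda *: y - u| <= lambda^-1 * `|L u|.
Proof.
move=> l0 Du Dy yE.
have [Dly Lly] := generatorZ lambda Dy.
have [Dw Lw] := generatorB Dly Du.
rewrite -ler_pdivrMl ?invr_gt0// invrK.
apply: le_trans (generator_dissipative _ Dw) _.
by rewrite Lw Lly scalerBr subrACA -scalerBr yE subKr.
Qed.

Lemma yosida_le lambda h : 0 < lambda -> D h -> D (L h) ->
  `|yosida T lambda h - L h| <= lambda^-1 * `|L (L h)|.
Proof.
move=> l0 Dh DLh; have [y [Dy yE ->]] := yosidaE l0 Dh.
exact: resolvent_residual_le.
Qed.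

(** Replace L h by u = A_t h, which is close to it and lies in D, and y by the
solution x for u: lambda |y - x| <= |L h - u| uniformly in lambda, while the
residual of x is O(1 / lambda). *)
Lemma yosida_cvg h : D h ->
  `|yosida T lambda h - L h| @[lambda --> +oo] --> 0.
Proof.
move=> Dh; apply/cvgr0Pnorm_le => e e0.
have e4 : 0 < e / 4 by rewrite divr_gt0.
near (0 : R)^'+ => t.
set u := A t h.
have Lhu : `|L h - u| <= e / 4.
  by rewrite /u; near: t; move/cvgrPdist_le: (generator_cvg Dh); exact.
have Du : D u by apply: generator_dom_difference_quotient => //; exact: ltW.
near=> lambda; rewrite normr_id.
have l0 : 0 < lambda by [].
have Lu : lambda^-1 * `|L u| <= e / 2.
  by rewrite ler_pdivrMl// -ler_pdivrMr ?divr_gt0.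
have [y [Dy yE ->]] := yosidaE l0 Dh.
have [x Dx xE] := generator_resolvent l0 Du.
have xu := resolvent_residual_le l0 Du Dx xE.
have [Dyx Lyx] := generatorB Dy Dx.
have yx := generator_dissipative lambda Dyx.
rewrite Lyx scalerBr subrACA yE xE in yx.
have -> : lambda *: y - L h = lambda *: (y - x) + (lambda *: x - u) + (u - L h).
  by rewrite scalerBr !addrA subrK subrK.
apply: le_trans (ler_normD _ _) _.
have := ler_normD (lambda *: (y - x)) (lambda *: x - u).
rewrite normrZ (gtr0_norm l0) [`|u - _|]distrC.
lra.
Unshelve. all: by end_near. Qed.

End contraction_semigroup.

(** * Completeness of the space of bounded continuous functions *)

Lemma mem_bcont (R : realType) (X : topologicalType) (u : X -> R) (M : R) :
  continuous u -> (forall x, `|u x| <= M) -> (u : X -> R^o) \in bcont.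
Proof. by move=> cu uM; apply/bcontP; split=> //; exists M. Qed.

Lemma bcfun_norm_ge (R : realType) (X : topologicalType) (h : bcfun R X) x :
  `|h x| <= `|h|.
Proof. exact: uniform_norm_ge. Qed.

Lemma bcfun_norm_le (R : realType) (X : topologicalType) (h : bcfun R X) M :
  0 <= M -> (forall x, `|h x| <= M) -> `|h| <= M.
Proof. exact: uniform_norm_le. Qed.

Section bcfun_complete.
Context {R : realType} {X : topologicalType}.

(** The pointwise limit is a uniform limit, hence continuous and bounded. *)
Lemma bcfun_complete (F : set_system (bcfun R X)) :
  ProperFilter F -> cauchy F -> cvg F.
Proof.
move=> FF /cauchyP Fc.
have Fd e : 0 < e -> exists h0, \forall h \near F, `|h0 - h| < e.
  by move=> /Fc[h0]; rewrite -ball_normE; exists h0.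
pose ev x (h : bcfun R X) : R := h x.
have ptw x : cvg (ev x @ F).
  apply/cauchy_cvgP/cauchy_exP => e /Fd[h0 h0P]; exists (h0 x).
  suff : \forall h \near F, ball (h0 x : R) e (ev x h) by [].
  apply: filterS h0P => h; rewrite -ball_normE; apply: le_lt_trans.
  exact: (bcfun_norm_ge (h0 - h)).
pose l x : R := lim (ev x @ F).
have lP e : 0 < e -> \forall h \near F, forall x, `|ev x h - l x| <= e.
  move=> e0; have [//|h0 h0P] := @Fd (e / 2); first by rewrite divr_gt0.
  near=> h => x.
  have hx : `|ev x h - ev x h'| @[h' --> F] --> `|ev x h - l x|.
    by apply: cvg_norm; apply: cvgB; [exact: cvg_cst|exact: ptw].
  rewrite -(cvg_lim _ hx)//; apply: limr_le.
    by apply/cvg_ex; eexists; exact: hx.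
  near=> h'.
  have h0h : `|h0 - h| < e / 2 by near: h.
  have h0h' : `|h0 - h'| < e / 2 by near: h'.
  apply: le_trans (bcfun_norm_ge (h - h') x) _.
  apply: le_trans (ler_distD h0 _ _) _.
  by rewrite [`|h - _|]distrC; lra.
have cl : continuous l.
  move=> x; apply/cvgrPdist_le => e e0.
  have e3 : 0 < e / 3 by rewrite divr_gt0.
  near F => h.
  have hl : forall x, `|h x - l x| <= e / 3 by near: h; exact: lP.
  near=> y.
  have hxy : `|h x - h y| <= e / 3.
    by near: y; move: (@bcfun_continuous _ _ h x) => /cvgrPdist_le; exact.
  have := hl x; have := hl y; rewrite !ler_norml => /andP[? ?] /andP[? ?].
  move: hxy; rewrite !ler_norml => /andP[? ?]; apply/andP; split; lra.
near F => h.
have hl : forall x, `|h x - l x| <= 1 by near: h; exact: lP.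
have lM x : `|l x| <= `|h| + 1.
  have := hl x; have := bcfun_norm_ge h x; rewrite !ler_norml.
  by move=> /andP[? ?] /andP[? ?]; apply/andP; split; lra.
apply/cvg_ex; exists (BCFun (mem_bcont cl lM)).
apply/cvgrPdist_le => e e0; near=> u.
rewrite distrC; apply: bcfun_norm_le; first exact: ltW.
by near: u; apply: (lP e).
Unshelve. all: by end_near. Qed.

HB.instance Definition _ := Uniform_isComplete.Build (bcfun R X) bcfun_complete.

End bcfun_complete.

(** * Differentiating along the flow *)

Section flow.
Context {R : realType} {d : nat} (Omega : set 'rV[R]_d).
Implicit Types (f : 'rV[R]_d -> 'rV[R]_d) (phi : R -> Omega -> Omega).

Lemma set_val_continuous : continuous (set_val : Omega -> 'rV[R]_d).
Proof. exact: initial_continuous. Qed.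

(** The local Lipschitz condition is about pairs of points of Omega near each
point of Omega x Omega; it is used near the diagonal point (x, x). *)
Lemma locally_lipschitz_continuous f :
  [locally [lipschitz f x | x in Omega]] ->
  continuous (fun x : Omega => f (set_val x)).
Proof.
move=> lf x; have Ox : Omega (set_val x) by exact: set_valP.
have /lf : (Omega `*` Omega) (set_val x, set_val x) by [].
rewrite /lipschitz_on /= => H.
near (pinfty_nbhs R) => M.
have : M.-lipschitz_on f (within (Omega `*` Omega) (nbhs (set_val x, set_val x))).
  by near: M.
move=> [[P Q] /= [Px Qx] PQ].
have M0 : 0 < M by [].
apply/(@cvgrPdist_le _ _ _ (nbhs x)) => e e0; near=> y.
have := PQ (set_val x, set_val y); rewrite /= => fxy.
apply: le_trans (fxy _ _) _.
- split; first exact: nbhs_singleton.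
  by near: y; exact: (set_val_continuous Qx).
- by split => //; exact: set_valP.
rewrite -ler_pdivlMl//; near: y.
have := @set_val_continuous x => /cvgrPdist_le; apply.
by rewrite mulr_gt0// invr_gt0.
Unshelve. all: by end_near. Qed.

(** By linearity of the differential, the derivative along f is the sum of the
products of the components of f with the partial derivatives of g. *)
Lemma lie_derivative_continuous f U (g : 'rV[R]_d -> R^o) :
  continuous (fun x : Omega => f (set_val x)) -> Omega `<=` U -> Cn_on 1 U g ->
  continuous (fun x : Omega => 'D_(f (set_val x)) g (set_val x) : R).
Proof.
move=> cf OU [dg cDg].
have -> : (fun x : Omega => 'D_(f (set_val x)) g (set_val x) : R) =
    (fun x => \sum_(i < d) f (set_val x) 0 i * 'D_(delta_mx 0 i) g (set_val x)).
  apply/funext => x; have Ux : U (set_val x) by apply/OU/set_valP.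
  rewrite deriveE; last exact: dg.
  rewrite [f (set_val x) in LHS]row_sum_delta linear_sum.
  by apply: eq_bigr => i _; rewrite linearZ/= -deriveE//; exact: dg.
apply: continuous_big => [|i _ x]; first exact: add_continuous.
apply: (@cvgM _ _ (nbhs x)).
  exact: (cvg_comp _ _ (@cf x) (@coord_continuous _ _ _ _ _ _)).
exact: (cvg_comp _ _ (@set_val_continuous x) (cDg _ _ (OU _ (set_valP _)))).
Qed.

Lemma orbit_continuous f phi (u : Omega -> R) x t : is_flow f phi ->
  continuous u -> {within `[0, t], continuous (fun s => u (phi s x))}.
Proof.
move=> /(_ x)[_ cphi _] cu.
apply: (@continuous_subspaceW _ _ `[0, t]%classic `[0, +oo[%classic).
  by move=> s /=; rewrite !in_itv/= andbT => /andP[].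
have cphi' : {within `[0, +oo[, continuous (fun s => phi s x)}.
  exact: (@continuous_comp_initial _ _ _ (set_val : Omega -> 'rV[R]_d)).
by move=> s; exact: (cvg_comp _ _ (@cphi' s) (@cu _)).
Qed.

Lemma orbit_MVT f phi U (g : 'rV[R]_d -> R^o) (h : bcfun R Omega) x t :
  is_flow f phi -> Omega `<=` U -> (forall y, U y -> differentiable g y) ->
  (forall y, h y = g (set_val y)) -> 0 < t ->
  exists2 s, 0 < s < t & h (phi t x) - h x =
    'D_(f (set_val (phi s x))) g (set_val (phi s x)) * t :> R.
Proof.
move=> flow OU dg hg t0.
have [phi0 _ dphi] := flow x.
pose df s : R := 'D_(f (set_val (phi s x))) g (set_val (phi s x)).
have dh s : s \in `]0, t[%R -> is_derive s 1 (fun s => h (phi s x) : R) (df s).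
  rewrite in_itv/= => /andP[s0 _].
  have dps := dphi s s0.
  have dgs : differentiable g (set_val (phi s x)) by apply/dg/OU/set_valP.
  have difp : differentiable (fun s => set_val (phi s x)) s.
    by apply/derivable1_diffP.
  have -> : (fun s => h (phi s x) : R) = g \o (fun s => set_val (phi s x)).
    by apply/funext => r /=; rewrite hg.
  apply: DeriveDef.
    by apply/derivable1_diffP; exact: differentiable_comp.
  rewrite deriveE; last exact: differentiable_comp.
  by rewrite diff_comp//= -[in LHS](deriveE _ difp) derive_val /df deriveE.
have [|s st] := MVT t0 dh.
  exact: (orbit_continuous flow (@bcfun_continuous _ _ h)).
by rewrite subr0 phi0 => E; exists s => //; move: st; rewrite in_itv.
Qed.

(** * Smooth functions in the domain of the Koopman generator *)

Section koopman.
Context f phi (K : R -> bcfun R Omega -> bcfun R Omega).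
Hypothesis phi_flow : is_flow f phi.
Hypothesis K_koopman : is_koopman phi K.

Lemma koopman_contraction t h : 0 <= t -> `|K t h| <= `|h|.
Proof.
move=> t0; apply: bcfun_norm_le => [|x]; first exact: normr_ge0.
by rewrite K_koopman//; exact: bcfun_norm_ge.
Qed.

Hypothesis K_continuous : forall h, K t h @[t --> 0^'+] --> h.

(** Strong continuity of the Koopman operators at h says that h varies little
along short pieces of orbits, uniformly in the starting point. *)
Lemma koopman_orbit_near (h : bcfun R Omega) e : 0 < e ->
  exists2 t0, 0 < t0 &
    forall t x, 0 <= t <= t0 -> `|(h (phi t x) : R) - h x| <= e.
Proof.
move=> e0; have /cvgrPdist_le/(_ e e0) := @K_continuous h.
move=> [t0 /= t0_gt0 Kh]; exists (t0 / 2); first by rewrite divr_gt0.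
move=> t x /andP[]; rewrite le_eqVlt => /predU1P[<- _|t_gt0 tt0].
  by have [-> _ _] := phi_flow x; rewrite subrr normr0 ltW.
rewrite -K_koopman ?(ltW t_gt0)// distrC.
apply: le_trans (bcfun_norm_ge (h - K t h) x) _.
apply: Kh => //=; rewrite sub0r normrN gtr0_norm//; lra.
Qed.

(** Strong continuity applies to bounded functions only, hence to cos k and
sin k rather than to k.  It keeps cos (k (phi s x) - k x) positive for s <= t,
with t independent of x.  As this angle starts at 0, depends continuously on s,
and cos 2 < 0, it stays below 2 in absolute value.  Finally k is at most
2 |h| / t at some point of the orbit piece, by the mean value hypothesis. *)
Lemma lie_derivative_bounded (h : bcfun R Omega) (k : Omega -> R) :
  continuous k ->
  (forall x t, 0 < t -> exists2 s, 0 < s < t &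
     h (phi t x) - h x = k (phi s x) * t :> R) ->
  exists M, forall x, `|k x| <= M.
Proof.
move=> ck hk.
have ccos : continuous (cos \o k).
  by move=> x; exact: (cvg_comp _ _ (@ck x) (@continuous_cos _ _)).
have csin : continuous (sin \o k).
  by move=> x; exact: (cvg_comp _ _ (@ck x) (@continuous_sin _ _)).
have cos1 x : `|(cos \o k) x| <= 1 by exact: cos_max.
have sin1 x : `|(sin \o k) x| <= 1 by exact: sin_max.
have h2 : 0 < 2^-1 :> R by [].
have [a a0 aP] := koopman_orbit_near (BCFun (mem_bcont ccos cos1)) h2.
have [b b0 bP] := koopman_orbit_near (BCFun (mem_bcont csin sin1)) h2.
pose t := Num.min a b.
have t0 : 0 < t by rewrite lt_min a0.
(* 2 - 2 cos (a - b) = (cos a - cos b)^2 + (sin a - sin b)^2 <= 1 / 2. *)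
have cos_gt0 s x : 0 <= s <= t -> 0 < cos (k (phi s x) - k x).
  move=> /andP[s0]; rewrite le_min => /andP[sa sb].
  have := aP s x; have := bP s x; rewrite s0 sa sb /= => /(_ isT) + /(_ isT).
  rewrite cosB; have := cos2Dsin2 (k x); have := cos2Dsin2 (k (phi s x)).
  rewrite !ler_norml => ? ? /andP[? ?] /andP[? ?]; nra.
have near2 s x : 0 <= s <= t -> `|k (phi s x) - k x| < 2.
  move=> /andP[s0 st]; rewrite ltNge; apply/negP => k2.
  have cth : {within `[0, s], continuous (fun r => `|k (phi r x) - k x|)}.
    apply: (@orbit_continuous f phi (fun y => `|k y - k x|)) => // y.
    apply: (@cvg_norm _ _ _ (nbhs y)); apply: (@cvgB _ _ _ (nbhs y)).
      exact: ck.
    exact: cvg_cst.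
  have [|r] := IVT s0 cth (_ : _ <= 2 <= _).
    have [-> _ _] := phi_flow x; rewrite subrr normr0.
    by rewrite ge_min le_max k2 orbT ler0n.
  rewrite in_itv/= => /andP[r0 rs] r2.
  have := @cos_gt0 r x; rewrite r0 (le_trans rs st) => /(_ isT).
  by rewrite -cos_norm r2 ltNge (ltW (cos2_lt0 _)).
exists (2 * `|h| / t + 2) => x.
have [s /andP[s0 st] hE] := hk x t t0.
have ks : `|k (phi s x)| <= 2 * `|h| / t.
  rewrite ler_pdivlMr// -[X in _ * X](gtr0_norm t0) -normrM -hE.
  apply: le_trans (ler_normB _ _) _.
  by rewrite mulr2n mulrDl mul1r lerD//; exact: bcfun_norm_ge.
have := @near2 s x; rewrite (ltW s0) (ltW st) => /(_ isT).
move: ks; rewrite ler_norml ltr_norml => /andP[? ?] /andP[? ?].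
by rewrite ler_norml; apply/andP; split; lra.
Qed.

(** The difference quotient at x is k (phi s x) for some s < t, and k (phi s x)
is uniformly close to k x by strong continuity at k, once k is known to be
bounded. *)
Lemma koopman_generator_dom (h : bcfun R Omega) :
  continuous (fun x : Omega => f (set_val x)) -> Cn 1 h -> generator_dom K h.
Proof.
move=> cf [U [g [_ OU [dg cDg] hg]]].
pose k (x : Omega) : R := 'D_(f (set_val x)) g (set_val x).
have ck : continuous k by exact: (lie_derivative_continuous cf OU (conj dg cDg)).
have hk x t : 0 < t -> exists2 s, 0 < s < t &
    h (phi t x) - h x = k (phi s x) * t :> R.
  by exact: (orbit_MVT x phi_flow OU dg hg).
have [M kM] := lie_derivative_bounded ck hk.
pose k' := BCFun (mem_bcont ck kM).
apply/cvg_ex; exists k'; apply/cvgrPdist_le => e e0.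
have [t0 t0_gt0 kP] := koopman_orbit_near k' e0.
near=> t.
have tgt0 : 0 < t by [].
have tt0 : t <= t0 by near: t; apply: nbhs_right_le.
rewrite distrC; apply: bcfun_norm_le => [|x]; first exact: ltW.
have -> : (difference_quotient K h t - k') x =
  t^-1 * ((K t h x : R) - h x) - k x :> R by [].
have [s /andP[s0 st] ->] : exists2 s, 0 < s < t &
    (K t h x : R) - h x = k (phi s x) * t.
  by rewrite K_koopman ?(ltW tgt0)//; exact: hk.
rewrite mulrC mulfK ?gt_eqF//.
by apply: kP; rewrite (ltW s0) (le_trans (ltW st) tt0).
Unshelve. all: by end_near. Qed.

End koopman.
End flow.

Lemma Cn2_Cn1 (R : realType) (d : nat) (Omega : set 'rV[R]_d)
  (h : bcfun R Omega) : Cn 2 h -> Cn 1 h.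
Proof.
move=> [U [g [oU OU [dg dDg] hg]]]; exists U, g; split=> //; split=> // v x Ux.
by apply: differentiable_continuous; exact: (dDg v).1.
Qed.

Theorem mainTheorem1 (R : realType) (d : nat) (Omega : set 'rV[R]_d)
  (f : 'rV[R]_d -> 'rV[R]_d) (phi : R -> Omega -> Omega)
  (K : R -> bcfun R Omega -> bcfun R Omega) (C omega omegat : R)
  (Omega_precompact : precompact Omega)
  (f_lipschitz : [locally [lipschitz f x | x in Omega]])
  (phi_flow : is_flow f phi)
  (K_koopman : is_koopman phi K)
  (K_semigroup : C0_semigroup K)
  (C_ge1 : 1 <= C) (omega_ge0 : 0 <= omega)
  (K_bound : forall t : R, 0 <= t -> forall h : bcfun R Omega,
     `|K t h| <= C * expR (omega * t) * `|h|)
  (omega_le : omega <= omegat) :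
  (forall h : bcfun R Omega, generator_dom K h ->
     `|yosida K lambda h - generator K h| @[lambda --> +oo] --> 0) /\
  exists2 c : R, 0 < c &
    forall h : bcfun R Omega, Cn 2 h ->
      generator_dom K h /\
      forall lambda : R, omegat < lambda ->
        (`|yosida K lambda h - generator K h|%:E <=
         (c * (lambda - omegat)^-1)%:E *
         (graph_norm (generator_dom K) (generator K) h +
          graph_norm (generator_dom K) (generator K) (generator K h)))%E.
Proof.
have [K_lin_cont _ K_add K_cont] := K_semigroup.
have K_lin t : 0 <= t -> linear (K t) by move=> /K_lin_cont[].
have K_contr t : 0 <= t -> forall h, `|K t h| <= `|h|.
  by move=> t0 h; exact: (koopman_contraction K_koopman).
have K_comm s t : 0 <= s -> 0 <= t -> forall h, K s (K t h) = K t (K s h).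
  by move=> s0 t0 h; rewrite -!K_add// addrC.
split; first exact: yosida_cvg.
exists 1 => // h /Cn2_Cn1 hC1.
have Dh : generator_dom K h.
  apply: koopman_generator_dom hC1 => //.
  exact: locally_lipschitz_continuous.
split=> // lambda lambda_gt.
have omegat_ge0 : 0 <= omegat by exact: le_trans omega_le.
have lambda_gt0 : 0 < lambda by exact: le_lt_trans lambda_gt.
have gap_gt0 : 0 < (lambda - omegat)^-1 by rewrite invr_gt0 subr_gt0.
rewrite mul1r {1}/graph_norm mem_set// /graph_norm.
(* Outside the domain the graph norm of L h is infinite. *)
case: ifPn => [/set_mem DLh|_]; last by rewrite addey// gt0_muley ?lte_fin// leey.
rewrite -EFinD -EFinM lee_fin.
apply: le_trans (yosida_le K_lin K_contr K_comm lambda_gt0 Dh DLh) _.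
apply: ler_pM => //; first by rewrite invr_ge0 ltW.
  by rewrite lef_pV2 ?posrE ?subr_gt0// gerBl.
by rewrite addrA lerDr !addr_ge0.
Qed.
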